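(* For each positive integer $n$, let $p_n\in(0,1)$, and suppose that $p_n\to 0$ as $n\to\infty$ and that $p_n\big/\frac{\log n}{n}\to\infty$ as $n\to\infty$. Let $\pi_{p_n,n}$ denote the stationary measure of the Markov chain $(\lambda^{(0)},\lambda^{(1)},\dotsc)$ on $\mathcal{P}(n)$ defined by the card-based stochastic Bulgarian solitaire $\mathscr{B}(n,p_n)$. Let $g(x)=e^{-x}$ for $x\ge 0$. Then $\pi_{p_n,n}$ has the limit shape $g$ with scaling $1/p_n$. In fact, for any $\varepsilon>0$, $$\pi_{p_n,n}\bigl(\{\lambda\in\mathcal{P}(n):\|\partial^{1/p_n}\lambda-g\|_\infty\leq\varepsilon\}\bigr)\geq 1-\exp\left[-\frac{\varepsilon^2}{2+\varepsilon}\,np_n\bigl(1-o(1)\bigr)\right],$$ where $o(1)$ denotes a quantity tending to $0$ as $n\to\infty$ (for fixed $\varepsilon$ and fixed sequence $p_n$).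
   Context: $\mathcal{P}(n)$ is the set of integer partitions $\lambda=(\lambda_1\ge\lambda_2\ge\dots\ge\lambda_\ell>0)$ of $n$, with the convention $\lambda_i=0$ for $i>\ell$. The card-based stochastic Bulgarian solitaire $\mathscr{B}(n,p)$, with $0<p<1$, is played with $n$ cards distributed in piles. In each move, every card is picked with probability $p$, independently of all other cards (and independently of the past and of the initial configuration), and the picked cards form a new pile (if no card is picked, the configuration is unchanged). Recording the multiset of positive pile sizes as a partition of $n$ gives a Markov chain $(\lambda^{(0)},\lambda^{(1)},\dotsc)$ on $\mathcal{P}(n)$. This chain is irreducible and aperiodic on a finite state space, so it has a unique stationary distribution, denoted $\pi_{p,n}$. For a scaling factor $a>0$ and $\lambda\in\mathcal{P}(n)$, the $a$-rescaled diagram-boundary function of $\lambda$ is $\partial^{a}\lambda:\mathbb{R}_{\ge 0}\to\mathbb{R}_{\ge 0}$, $\partial^{a}\lambda(x)=\frac{a}{n}\lambda_{\lfloor ax\rfloor+1}$. For a function $h$ on $[0,\infty)$, $\|h\|_\infty=\sup\{|h(x)|:x\ge 0\}$. A sequence of probability distributions $\nu^{(n)}$ on $\mathcal{P}(n)$, $n\ge 1$, has the limit shape $\phi:\mathbb{R}_{\ge 0}\to\mathbb{R}_{\ge 0}$ with scaling $\{a_n\}$ if, for every $\delta>0$, $\lim_{n\to\infty}\nu^{(n)}\{\lambda\in\mathcal{P}(n):\|\partial^{a_n}\lambda-\phi\|_\infty<\delta\}=1$. *)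

(* Defs.v *)
From HB Require Import structures.
From mathcomp Require Import all_boot all_order all_algebra.
From mathcomp Require Import all_classical all_reals all_analysis.
Set Implicit Arguments.
Unset Strict Implicit.
Unset Printing Implicit Defensive.
Import Order.TTheory GRing.Theory Num.Theory.
Import numFieldNormedType.Exports.

Local Open Scope ring_scope.

Definition is_intpart (n : nat) (s : seq nat) : bool :=
  [&& sorted geq s, all (fun k => 0 < k)%N s & sumn s == n].

Record intpart (n : nat) : Type :=
  IntPart { parts :> seq nat; partsP : is_intpart n parts }.

HB.instance Definition _ n := [isSub for @parts n].
HB.instance Definition _ n := [Countable of intpart n by <:].

Section Finite.
Variable n : nat.

Lemma mem_le_sumn (s : seq nat) k : k \in s -> (k <= sumn s)%N.
Proof.
elim: s => //= a s IH; rewrite inE => /orP[/eqP->|/IH]; first exact: leq_addr.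
by move=> h; apply: leq_trans h _; exact: leq_addl.
Qed.

Lemma size_le_sumn (s : seq nat) : all (fun k => 0 < k)%N s -> (size s <= sumn s)%N.
Proof. by elim: s => //= a s IH /andP[a0 /IH h]; rewrite -add1n leq_add. Qed.

Definition intpart_code (l : intpart n) : n.-bseq 'I_n.+1 :=
  insub_bseq n (map inord (parts l)).
Definition intpart_decode (b : n.-bseq 'I_n.+1) : option (intpart n) :=
  insub (map val b).

Lemma intpart_codeK : pcancel intpart_code intpart_decode.
Proof.
move=> l; rewrite /intpart_decode /intpart_code.
have /and3P[_ hp /eqP hs] := partsP l.
have -> : map val (insub_bseq n (map inord (parts l)) : n.-bseq 'I_n.+1) = parts l.
  rewrite /insub_bseq insubdK; last first.
    by rewrite -topredE /= size_map (leq_trans (size_le_sumn hp)) // hs.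
  rewrite -map_comp -[RHS]map_id; apply/eq_in_map => k hk /=.
  by rewrite inordK // ltnS (leq_trans (mem_le_sumn hk)) // hs.
exact: valK.
Qed.

End Finite.

HB.instance Definition _ n : fintype.isFinite (intpart n) :=
  PCanIsFinite (@intpart_codeK n).

(* lambda_(i+1); zero beyond the last part *)
Definition part (n : nat) (l : intpart n) (i : nat) : nat := nth 0%N l i.

(* The n cards, grouped by the pile containing them. *)
Definition cards (n : nat) (l : intpart n) : finType :=
  {i : 'I_(size l) & 'I_(part l i)}.

Definition new_piles (n : nat) (l : intpart n) (S : {set cards l}) : seq nat :=
  #|S| :: [seq #|[pred c | (c \notin S) && (tag c == i)]| | i <- enum 'I_(size l)].

Definition move_parts (n : nat) (l : intpart n) (S : {set cards l}) : seq nat :=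
  sort geq [seq k <- new_piles S | (0 < k)%N].

Lemma card_cards n (l : intpart n) : #|{: cards l}| = n.
Proof.
have /and3P[_ _ /eqP hs] := partsP l.
rewrite card_tagged sumnE big_map -[RHS]hs sumnE (big_nth 0%N) big_mkord.
by rewrite big_enum /=; apply: eq_bigr => i _; rewrite card_ord.
Qed.

Lemma move_partsP n (l : intpart n) (S : {set cards l}) :
  is_intpart n (move_parts S).
Proof.
apply/and3P; split.
- by apply: sort_sorted => x y; exact: leq_total.
- by rewrite all_sort filter_all.
- rewrite /move_parts (perm_sumn (s2 := [seq k <- new_piles S | (0 < k)%N])).
    have -> : sumn [seq k <- new_piles S | (0 < k)%N] = sumn (new_piles S).
      by elim: (new_piles S) => //= -[|a] s IH //=; rewrite IH.
    rewrite /= sumnE big_map big_enum /=.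
    have -> : (\sum_(i < size l) #|[pred c : cards l | (c \notin S) && (tag c == i)]|)%N
              = #|~: S|.
      rewrite -sum1_card (partition_big (fun c : cards l => tag c) predT) //=.
      by apply: eq_bigr => i _; rewrite -sum1_card; apply: eq_bigl => c;
         rewrite !inE.
    by rewrite cardsC card_cards.
  by rewrite perm_sort.
Qed.

(* The configuration obtained when the set of picked cards is S. *)
Definition move (n : nat) (l : intpart n) (S : {set cards l}) : intpart n :=
  IntPart (move_partsP S).

(* One-step transition probability of B(n,p): the set of picked cards is S with
   probability p^|S| (1-p)^(n-|S|). *)
Definition trans (R : realType) (p : R) (n : nat) (l m : intpart n) : R :=
  \sum_(S : {set cards l} | move S == m) p ^+ #|S| * (1 - p) ^+ #|~: S|.

Definition is_distr (R : realType) (T : finType) (nu : T -> R) : Prop :=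
  (forall t, 0 <= nu t) /\ \sum_t nu t = 1.

Definition is_stationary (R : realType) (p : R) (n : nat) (nu : intpart n -> R) :
    Prop :=
  is_distr nu /\ forall m, \sum_l nu l * trans p l m = nu m.

Definition Pr (R : realType) (T : finType) (nu : T -> R) (A : set T) : R :=
  \sum_(t | t \in A) nu t.

(* Taken in the extended reals: the real-valued sup is 0 on unbounded sets. *)
Definition supnorm (R : realType) (h : R -> R) : \bar R :=
  ereal_sup [set (`|h x|)%:E | x in [set x : R | 0 <= x]]%classic.

(* Only the values at x >= 0 are meaningful, where truncn is the floor. *)
Definition boundary (R : realType) (a : R) (n : nat) (l : intpart n) (x : R) : R :=
  a / n%:R * (part l (Num.truncn (a * x)))%:R.

(* nu 0 plays no role. *)
Definition has_limit_shape (R : realType) (nu : forall n, intpart n -> R)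
    (phi : R -> R) (a : nat -> R) : Prop :=
  forall delta : R, 0 < delta ->
    (Pr (nu n) [set l : intpart n |
        (supnorm (fun x => boundary (a n) l x - phi x)%R < delta%:E)%E]%classic
      @[n --> \oo] --> (1 : R))%classic.

Section Stationary.
Variables (R : realType) (p : R) (n : nat).
Hypothesis p01 : 0 < p < 1.
Local Notation T := (intpart n).
Local Notation P := (@trans R p n).
Local Notation full l := (finset.setTfor (cards l)).

Lemma trans_ge0 l m : 0 <= P l m.
Proof.
case/andP: p01 => p0 p1; apply: sumr_ge0 => S _.
by rewrite mulr_ge0 // exprn_ge0 ?subr_ge0 // ltW.
Qed.

Lemma sum_trans l : \sum_m P l m = 1.
Proof.
rewrite /trans.
transitivity (\sum_(S : {set cards l}) p ^+ #|S| * (1 - p) ^+ #|~: S|).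
  by rewrite [RHS](partition_big (fun S : {set cards l} => move S) predT).
transitivity (\prod_(c : cards l) (p + (1 - p))); last first.
  by rewrite big1 // => c _; rewrite addrC subrK.
rewrite bigA_distr; apply: eq_bigr => S _.
rewrite -!prodr_const [RHS](bigID (mem S)) /=; congr (_ * _).
  by apply: eq_bigr => c ->.
by apply: eq_big => [c|c]; rewrite inE // => /negPf->.
Qed.

Lemma move_setT (l l' : T) : move (full l) = move (full l').
Proof.
suff E : forall k : T, parts (move (full k)) = [seq i <- [:: n] | (0 < i)%N].
  by apply: val_inj; rewrite [LHS](E l) [RHS](E l').
move=> k; rewrite /= /move_parts /new_piles cardsT card_cards.
have -> : [seq #|[pred c | (c \notin (full k)) && (tag c == i)]|
            | i <- enum 'I_(size k)] = nseq (size k) 0%N.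
  rewrite (eq_map (g := fun=> 0%N)); last first.
    by move=> i; apply: eq_card0 => c; rewrite !inE.
  by rewrite -[in RHS](size_enum_ord (size k)); elim: (enum _) => //= a s ->.
rewrite /=; have -> : [seq i <- nseq (size k) 0%N | (0 < i)%N] = [::].
  by elim: (size _).
by case: (0 < n)%N.
Qed.

Lemma trans_setT_gt0 (l l' : T) : 0 < P l (move (full l')).
Proof.
case/andP: p01 => p0 p1; rewrite (move_setT l' l) /trans.
rewrite (bigD1 (full l)) //= ltr_pwDl //.
  by rewrite mulr_gt0 // exprn_gt0 ?subr_gt0.
apply: sumr_ge0 => S _.
by rewrite mulr_ge0 // exprn_ge0 ?subr_ge0 // ltW.
Qed.

Let inv (v : T -> R) := forall m, \sum_l v l * P l m = v m.

Lemma inv_norm v : inv v -> inv (fun l => `|v l|).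
Proof.
move=> hv m.
have h k : 0 <= \sum_l `|v l| * P l k - `|v k|.
  rewrite subr_ge0 -[in leLHS]hv (le_trans (ler_norm_sum _ _ _)) //.
  by apply: ler_sum => l _; rewrite normrM (ger0_norm (trans_ge0 _ _)).
have /psumr_eq0P : \sum_k (\sum_l `|v l| * P l k - `|v k|) = 0.
  rewrite sumrB exchange_big /=; apply/eqP; rewrite subr_eq0; apply/eqP.
  by apply: eq_bigr => l _; rewrite -mulr_sumr sum_trans mulr1.
by move=> /(_ (fun k _ => h k) m isT) /eqP; rewrite subr_eq0 => /eqP.
Qed.

Lemma inv_ge0 v (l0 : T) : inv v -> 0 <= v (move (full l0)) ->
  forall l, 0 <= v l.
Proof.
move=> hv v0 l; have hn := inv_norm hv.
have hw : inv (fun l => `|v l| - v l).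
  by move=> m; rewrite -(hn m) -[X in _ = _ - X]hv -sumrB; apply: eq_bigr => k _;
     rewrite mulrBl.
have := hw (move (full l0)).
rewrite (ger0_norm v0) subrr => /psumr_eq0P h.
have /eqP : (`|v l| - v l) * P l (move (full l0)) = 0.
  by apply: h => // k _; rewrite mulr_ge0 ?trans_ge0 // subr_ge0 ler_norm.
by rewrite mulf_eq0 (gt_eqF (trans_setT_gt0 _ _)) orbF subr_eq0 => /eqP <-.
Qed.

Lemma inv_eq0 v : inv v -> \sum_l v l = 0 -> forall l, v l = 0.
Proof.
move=> hv s0 l; have [h|h] := leP 0 (v (move (full l))).
  by move/psumr_eq0P: s0; apply=> // k _; exact: (inv_ge0 hv h).
have hN : inv (fun l => - v l).
  by move=> m; rewrite -[in RHS]hv -sumrN; apply: eq_bigr => k _; rewrite mulNr.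
apply/eqP; rewrite -oppr_eq0; apply/eqP.
have sN : \sum_l - v l = 0 by rewrite sumrN s0 oppr0.
move/psumr_eq0P: sN; apply=> // k _; apply: (inv_ge0 (l0 := l) hN).
by rewrite oppr_ge0 ltW.
Qed.

Lemma stationary_unique (nu nu' : T -> R) :
  is_stationary p nu -> is_stationary p nu' -> nu = nu'.
Proof.
move=> [[_ s1] h1] [[_ s2] h2]; apply/funext => l; apply/eqP.
rewrite -subr_eq0; apply/eqP; apply: (inv_eq0 (v := fun l => nu l - nu' l)).
  by move=> m; rewrite -h1 -h2 -sumrB; apply: eq_bigr => k _; rewrite mulrBl.
by rewrite sumrB s1 s2 subrr.
Qed.

Lemma intpart_inhabited : T.
Proof.
suff h : is_intpart n (nseq n 1%N) by exact: IntPart h.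
apply/and3P; split; last by rewrite sumn_nseq mul1n.
  by apply/(sortedP 0%N) => i; rewrite size_nseq => hi;
     rewrite !nth_nseq hi (ltnW hi).
by apply/allP => k /nseqP[->].
Qed.

Lemma stationary_exists : exists nu : T -> R, is_stationary p nu.
Proof.
pose M : 'M[R]_#|{: T}| :=
  \matrix_(i, j) P (enum_val i) (enum_val j).
have E (v : 'rV[R]_#|{: T}|) j :
    (v *m (M - 1%:M)) 0 (enum_rank j)
      = \sum_l v 0 (enum_rank l) * P l j - v 0 (enum_rank j).
  rewrite mulmxBr mulmx1 !mxE; congr (_ - _).
  rewrite (reindex (@enum_rank T)) /=; last exact/onW_bij/enum_rank_bij.
  by apply: eq_bigr => l _; rewrite mxE !enum_rankK.
have : \det (M - 1%:M) == 0.
  rewrite -det_tr; apply/det0P; exists (const_mx 1).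
    apply/eqP => /matrixP /(_ 0 (enum_rank intpart_inhabited)).
    by rewrite !mxE => /eqP; rewrite oner_eq0.
  apply/rowP => i; rewrite linearB /= trmx1 mulmxBr mulmx1 !mxE.
  apply/eqP; rewrite subr_eq0; apply/eqP.
  rewrite -[RHS](sum_trans (enum_val i)).
  rewrite (reindex (@enum_rank T)) /=; last exact/onW_bij/enum_rank_bij.
  by apply: eq_bigr => l _; rewrite !mxE mul1r enum_rankK.
case/det0P => v v0 hv.
pose w l := `|v 0 (enum_rank l)|.
have hw : inv w.
  apply: (@inv_norm (fun l => v 0 (enum_rank l))) => m.
  by apply/eqP; rewrite -subr_eq0 -E hv mxE.
have w0 : 0 < \sum_l w l.
  rewrite lt_neqAle sumr_ge0 ?andbT => [|l _]; last exact: normr_ge0.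
  apply: contra v0; rewrite eq_sym => /eqP /psumr_eq0P h.
  apply/eqP/rowP => i; rewrite mxE; apply/eqP; rewrite -normr_eq0 -(enum_valK i).
  by apply/eqP/h => // l _; exact: normr_ge0.
exists (fun l => w l / \sum_l w l); split; first split.
- by move=> l; rewrite divr_ge0 ?normr_ge0 // ltW.
- by rewrite -mulr_suml divff // gt_eqF.
- by move=> m; rewrite -[in RHS]hw mulr_suml; apply: eq_bigr => l _; rewrite mulrAC.
Qed.

End Stationary.

(* Main.v *)
(* Label every card by its age, the number of moves since it was last picked.
   After M moves, whatever the initial configuration, the ages of the n cards
   are independent and each equals i < M with probability p (1-p)^i, so the pile
   created i moves ago has a binomial size with mean n p (1-p)^i.  Chernoff's
   inequality for each i < M, together with the bound n (1-p)^M on the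
   probability that some card is older than M, shows that all pile sizes are
   uniformly within e n p of these means, up to probability
   n (1-p)^M + 2 M exp (- n p e^2/(2+e)); sorting the piles does not increase the
   uniform distance to a nonincreasing sequence.  The step function of the means
   is within p/(1-p) of exp(-x), hence the choice e = eps - p/(1-p).  With M a
   constant multiple of n, the prefactors are at most n^2 = exp (2 ln n), which
   is exp (o(n p)) because n p / ln n tends to infinity. *)
Require Import Defs.
From mathcomp Require Import all_boot all_order all_algebra.
From mathcomp Require Import all_classical all_reals all_analysis.
From mathcomp Require Import ring lra.
Set Implicit Arguments.
Unset Strict Implicit.
Unset Printing Implicit Defensive.
Import Order.TTheory GRing.Theory Num.Theory.
Import numFieldNormedType.Exports.
Local Open Scope ring_scope.

(** * Partitions as fibre sizes of labellings *)

Section Fibres.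
Variables (C : finType) (L : eqType) (f : C -> L).

(* Fibres of [f] are the piles, [C] being the set of cards. *)
Definition fib (x : L) : nat := #|[pred c | f c == x]|.

Definition labels : seq L := undup (codom f).

Definition fib_sizes : seq nat := [seq fib x | x <- labels].

Lemma mem_labels x : (x \in labels) = (0 < fib x)%N.
Proof.
rewrite mem_undup; apply/codomP/card_gt0P => [[c ->]|[c]].
  by exists c; rewrite inE.
by rewrite inE => /eqP <-; exists c.
Qed.

Lemma fib_gt0 c : (0 < fib (f c))%N.
Proof. by rewrite -mem_labels mem_undup codom_f. Qed.

Lemma sum_labels (F : C -> nat) :
  (\sum_(x <- labels) \sum_(c | f c == x) F c = \sum_c F c)%N.
Proof.
rewrite (exchange_big_dep predT) //=; apply: eq_bigr => c _.
rewrite big_mkcond (bigD1_seq (f c)) ?undup_uniq ?mem_labels ?fib_gt0 //=.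
rewrite eqxx big1 ?addn0 // => x; rewrite eq_sym => /negPf ->.
by [].
Qed.

Lemma sumn_fib_sizes : sumn fib_sizes = #|C|.
Proof.
rewrite sumnE big_map -sum1_card -sum_labels.
by apply: eq_bigr => x _; rewrite sum1_card.
Qed.

Lemma all_fib_sizes_gt0 : all (fun k => 0 < k)%N fib_sizes.
Proof. by rewrite all_map; apply/allP => x; rewrite mem_labels. Qed.

Lemma count_fib_sizes k :
  (k * count_mem k fib_sizes = #|[pred c | fib (f c) == k]|)%N.
Proof.
rewrite -[RHS]sum1_card big_mkcond -sum_labels /=.
rewrite count_map -sum1_count big_distrr /= big_mkcond /=.
apply: eq_bigr => x _; rewrite -big_mkcondr /=.
rewrite (eq_bigl (fun c => (f c == x) && (fib x == k))); last first.
  by move=> c; rewrite inE; case: eqP => //= ->.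
case: eqP => [<-|_].
  by rewrite muln1 /fib -[LHS]sum1_card; apply: eq_bigl => c; rewrite inE andbT.
by rewrite big_pred0 // => c; rewrite andbF.
Qed.

(** Labels in [s] that [f] does not take have empty fibres, which the filter drops; so piles may be
    enumerated along any convenient list covering the image. *)
Lemma perm_fib_sizes_labels (s : seq L) :
  uniq s -> (forall c, f c \in s) ->
  perm_eq [seq k <- [seq fib x | x <- s] | (0 < k)%N] fib_sizes.
Proof.
move=> us fs; rewrite filter_map; apply: perm_map.
apply: uniq_perm; rewrite ?filter_uniq ?undup_uniq // => x.
rewrite mem_filter /= mem_labels; have [/card_gt0P[c]|//] := boolP (0 < fib x)%N.
by rewrite inE => /eqP <-; rewrite fs.
Qed.

Definition profile_parts : seq nat := sort geq fib_sizes.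

Lemma profile_partsP n : #|C| = n -> is_intpart n profile_parts.
Proof.
move=> hC; apply/and3P; split.
- by apply: sort_sorted => x y; exact: leq_total.
- by rewrite all_sort all_fib_sizes_gt0.
- by rewrite (perm_sumn (s2 := fib_sizes)) ?perm_sort // sumn_fib_sizes hC.
Qed.

Definition profile n (hC : #|C| = n) : intpart n := IntPart (profile_partsP hC).

End Fibres.

(** * Moves as relabellings of the cards *)

Lemma sort_geq_eq (s t : seq nat) : perm_eq s t -> sort geq s = sort geq t.
Proof.
move=> h; apply/perm_sortP => //.
- by move=> x y; exact: leq_total.
- by move=> x y z /= h1 h2; exact: leq_trans h2 h1.
- by move=> x y /andP[/= h1 h2]; apply/eqP; rewrite eqn_leq h1 h2.
Qed.

(* Both lists have the same multiplicities: [k] times the multiplicity of [k]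
   counts the points lying in a fibre of size [k]. *)
Lemma perm_fib_sizes (C C' : finType) (L L' : eqType) (f : C -> L) (f' : C' -> L')
    (b : C -> C') :
  bijective b -> (forall x y, (f x == f y) = (f' (b x) == f' (b y))) ->
  perm_eq (fib_sizes f) (fib_sizes f').
Proof.
move=> bb ker.
have fibE x : fib f (f x) = fib f' (f' (b x)).
  rewrite /fib -!sum1_card [RHS](reindex b) /=; last exact: onW_bij.
  by apply: eq_bigl => y; rewrite !inE ker.
apply/allP => k _; apply/eqP; case: k => [|k].
  rewrite !(count_memPn _) //.
    by apply/negP => /(allP (all_fib_sizes_gt0 f')).
  by apply/negP => /(allP (all_fib_sizes_gt0 f)).
apply/eqP; rewrite -(eqn_pmul2l (ltn0Sn k)) !count_fib_sizes; apply/eqP.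
rewrite -!sum1_card [RHS](reindex b) /=; last exact: onW_bij.
by apply: eq_bigl => y; rewrite !inE fibE.
Qed.

(** Labelling each card by its pile recovers the partition, so every configuration can serve as a
    start of the labelled process. *)
Lemma profile_tag n (l : intpart n) :
  profile (fun c : cards l => tag c) (card_cards l) = l.
Proof.
apply: val_inj; rewrite /= /profile_parts.
have /and3P[hs hp _] := partsP l.
have hfib i : fib (fun c : cards l => tag c) i = part l i.
  rewrite /fib -[RHS]card_ord
    -(card_imset _ (@eq_from_Tagged _ (fun i : 'I_(size l) => 'I_(part l i)) i)).
  apply: eq_card => u; rewrite inE; apply/eqP/imsetP => [<-|[d _ -> //]].
  by exists (tagged u) => //; rewrite taggedK.
have hE : [seq k <- [seq fib (fun c : cards l => tag c) x
                    | x <- enum 'I_(size l)] | (0 < k)%N] = l.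
  rewrite (eq_map hfib) -[RHS](mkseq_nth 0%N) /mkseq -val_enum_ord -map_comp.
  apply/all_filterP; rewrite all_map; apply/allP => i _ /=.
  exact/(allP hp)/mem_nth.
rewrite (@sort_geq_eq _ l) ?sorted_sort //.
  by move=> x y z /= h1 h2; exact: leq_trans h2 h1.
rewrite -[X in perm_eq _ X]hE perm_sym; apply: perm_fib_sizes_labels.
  exact: enum_uniq.
by move=> c; rewrite mem_enum.
Qed.

(** A move is a relabelling: picked cards receive the fresh label [None], the others keep their
    pile. *)
Lemma move_profile n (l : intpart n) (S : {set cards l}) :
  move S = profile (fun c => if c \in S then None else Some (tag c)) (card_cards l).
Proof.
set g := fun c => _.
apply: val_inj; rewrite /= /move_parts /profile_parts.
apply: sort_geq_eq.
have -> : new_piles S = [seq fib g x | x <- None :: [seq Some i | i <- enum 'I_(size l)]].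
  rewrite /new_piles /= -map_comp; congr (_ :: _).
    by apply: eq_card => c; rewrite inE /g; case: ifP.
  by apply: eq_map => i /=; apply: eq_card => c; rewrite !inE /g; case: ifP.
apply: perm_fib_sizes_labels.
  rewrite /= map_inj_uniq ?enum_uniq ?andbT; last by move=> i j [].
  by apply/mapP => -[].
move=> c; rewrite /g; case: ifP => _; rewrite inE //=.
by rewrite map_f // mem_enum.
Qed.

(* Sorting the labels by decreasing fibre size puts the points of [C] in
   bijection with the cells of the Young diagram of [profile f]. *)
Lemma profile_bij n (C : finType) (L : eqType) (f : C -> L) (hC : #|C| = n) :
  exists2 b : C -> cards (profile f hC), bijective b &
    forall x y, (f x == f y) = (tag (b x) == tag (b y)).
Proof.
pose labs := sort (fun x y => fib f y <= fib f x)%N (labels f).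
have hl : parts (profile f hC) = [seq fib f x | x <- labs].
  by rewrite /= /profile_parts /fib_sizes sort_map.
have fl c : f c \in labs by rewrite mem_sort mem_labels fib_gt0.
have hi c : (index (f c) labs < size (profile f hC))%N.
  by rewrite hl size_map index_mem.
have hj c : (index c (enum [pred d | f d == f c]) < part (profile f hC) (index (f c) labs))%N.
  rewrite /part hl (nth_map (f c)) /= ?index_mem // nth_index //.
  by rewrite /fib cardE index_mem mem_enum inE.
pose b c : cards (profile f hC) :=
  Tagged (fun i : 'I_(size (profile f hC)) => 'I_(part (profile f hC) i))
    (i := Ordinal (hi c)) (Ordinal (hj c)).
have bf x y : (f x == f y) = (tag (b x) == tag (b y)).
  apply/eqP/eqP => [h|[h]]; first by apply: val_inj; rewrite /= h.
  by rewrite -(nth_index (f x) (fl x)) h nth_index.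
exists b => //; apply: inj_card_bij; last by rewrite card_cards hC.
move=> x y bxy.
have fxy : f x = f y by apply/eqP; rewrite bf bxy.
have : val (tagged (b x)) = val (tagged (b y)) by rewrite bxy.
rewrite /= fxy => h.
have hx : x \in enum [pred d | f d == f y] by rewrite mem_enum inE fxy.
have hy : y \in enum [pred d | f d == f y] by rewrite mem_enum inE.
by rewrite -(nth_index x hx) h nth_index.
Qed.

(** * Sorting and uniform distance *)

(** This is conjugation of Young diagrams. Positivity of [k] excludes the default value 0 of [nth]
    beyond the end of the list. *)
Lemma leq_nth_sorted (s : seq nat) k i : sorted geq s -> (0 < k)%N ->
  (k <= nth 0 s i)%N = (i < count (leq k) s)%N.
Proof.
move=> + k0; elim: s i => [|x s IH] i hs; first by rewrite nth_nil leqNgt k0.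
have /allP hx : all (geq x) s.
  by apply: order_path_min hs => a b c /= h1 h2; exact: leq_trans h2 h1.
have {}IH := IH _ (path_sorted hs).
have [kx|xk] /= := leqP k x; first by case: i => [|i] /=; rewrite kx ?IH.
rewrite (@eq_in_count _ _ pred0) ?count_pred0; last first.
  by move=> y /hx /= yx; apply/negbTE; rewrite -ltnNge (leq_ltn_trans yx).
rewrite addn0 (leqNgt k x) xk ltn0; apply/negbTE; rewrite -ltnNge.
case: i => [|i] //=.
have [si|si] := ltnP i (size s); last by rewrite nth_default.
by apply: leq_ltn_trans xk; apply: hx; rewrite mem_nth.
Qed.

Lemma leq_part_profile n (C : finType) (L : eqType) (f : C -> L) (hC : #|C| = n) k i :
  (0 < k)%N ->
  (k <= part (profile f hC) i)%N = (i < size [seq x <- labels f | k <= fib f x])%N.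
Proof.
move=> k0; rewrite /part leq_nth_sorted //; last first.
  by have /and3P[] := partsP (profile f hC).
rewrite size_filter /= /profile_parts.
have /seq.permP -> : perm_eq (sort geq (fib_sizes f)) (fib_sizes f) by rewrite perm_sort.
by rewrite count_map.
Qed.

(** By pigeonhole, the sorted value at [i] is at most some fibre with label at least [i], and at
    least some fibre with label at most [i]; monotonicity compares [a] at these labels with
    [a i]. *)
Lemma part_profile_dist (R : realType) n (C : finType) (f : C -> nat) (hC : #|C| = n)
    (a : nat -> R) (t : R) :
  (forall i j, (i <= j)%N -> a j <= a i) ->
  (forall j, `|(fib f j)%:R - a j| <= t) ->
  forall i, `|(part (profile f hC) i)%:R - a i| <= t.
Proof.
move=> adec hN i; set k := part _ i.
rewrite ler_norml; apply/andP; split; last first.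
  have t0 : 0 <= t by exact: le_trans (normr_ge0 _) (hN 0%N).
  have [k0|k0] := posnP k.
    (* The sign of [a] is unknown, so this case uses a label beyond [i] and beyond all values of
       [f], whose fibre is empty. *)
    rewrite k0 sub0r; have := hN (maxn i (\max_c f c).+1).
    set j := maxn _ _; have -> : fib f j = 0%N.
      apply: eq_card0 => c; rewrite inE; apply/negbTE; rewrite neq_ltn.
      by rewrite /j leq_max ltnS leq_bigmax orbT.
    rewrite ler_norml => /andP[_ h].
    by have := adec _ _ (leq_maxl i (\max_c f c).+1); rewrite -/j; lra.
  have : (k <= part (profile f hC) i)%N by [].
  rewrite leq_part_profile // => hi.
  (* More than [i] labels have a fibre of size at least [k], too many to lie all below [i]. *)
  have [j hj ij] : exists2 j, (k <= fib f j)%N & (i <= j)%N.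
    apply/not_exists2P => hno.
    have hs : {subset [seq x <- labels f | (k <= fib f x)%N] <= iota 0 i}.
      move=> x; rewrite mem_filter mem_iota /= => /andP[hx _].
      by case: (hno x) => //; rewrite ltnNge => /negP.
    have := uniq_leq_size (filter_uniq _ (undup_uniq _)) hs.
    by rewrite size_iota leqNgt hi.
  have := hN j; rewrite ler_norml => /andP[_ h].
  have := adec _ _ ij; have : k%:R <= (fib f j)%:R :> R by rewrite ler_nat.
  lra.
have /negP : ~~ (k.+1 <= part (profile f hC) i)%N by rewrite -leqNgt.
rewrite leq_part_profile // => /negP; rewrite -leqNgt => hi.
(* At most [i] labels have a fibre larger than [k], so one of the [i.+1] labels up to [i] does
   not. *)
have [j hj ji] : exists2 j, (fib f j <= k)%N & (j <= i)%N.
  apply/not_exists2P => hno.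
  have hs : {subset iota 0 i.+1 <= [seq x <- labels f | (k < fib f x)%N]}.
    move=> x; rewrite mem_filter mem_iota /= add0n ltnS => hx.
    have kx : (k < fib f x)%N by case: (hno x) => // /negP; rewrite -ltnNge.
    by rewrite kx mem_labels (leq_ltn_trans _ kx).
  have := uniq_leq_size (iota_uniq _ _) hs.
  by rewrite size_iota leqNgt ltnS hi.
have := hN j; rewrite ler_norml => /andP[h _].
have := adec _ _ ji; have : (fib f j)%:R <= k%:R :> R by rewrite ler_nat.
lra.
Qed.

(** * The chain of card ages *)

Section LabelledMove.
Variables (R : realType) (p : R).

(** Expectation over a random set [S] that contains each card independently with probability [p]. *)
Definition avg (C : finType) (G : {set C} -> R) : R :=
  \sum_(S : {set C}) p ^+ #|S| * (1 - p) ^+ #|~: S| * G S.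

(** Shifting the old labels makes 0 fresh, so the picked cards form a pile of their own and the
    other piles stay apart. *)
Definition step (C : finType) (f : C -> nat) (S : {set C}) : C -> nat :=
  fun c => if c \in S then 0%N else (f c).+1.

Definition trans_op n (F : intpart n -> R) (l : intpart n) : R :=
  \sum_m trans p l m * F m.

(* The labelled chain lumps to the chain on partitions. *)
Lemma avg_step_profile n (C : finType) (f : C -> nat) (hC : #|C| = n)
    (F : intpart n -> R) :
  avg (fun S => F (profile (step f S) hC)) = trans_op F (profile f hC).
Proof.
have [b bb hb] := profile_bij f hC.
transitivity (avg (fun S : {set cards (profile f hC)} => F (move S))).
  rewrite /avg [RHS](reindex (fun S : {set C} => b @: S)) /=; last first.
    case: bb => b' K K'; exists (fun S : {set cards (profile f hC)} => b' @: S) => S _;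
      by rewrite -imset_comp (eq_imset (g := id)) ?imset_id.
  apply: eq_bigr => S _; rewrite card_imset; last exact: bij_inj.
  have -> : #|~: (b @: S)| = #|~: S|.
    apply: (@addnI #|S|); rewrite -{1}(card_imset S (bij_inj bb)) !cardsC.
    by rewrite hC card_cards.
  (* Through [b], the labels 0 and [None] both mark the picked cards, and two unpicked cards share a
     label exactly when they did before. *)
  congr (_ * F _); rewrite move_profile; apply: val_inj => /=.
  apply: sort_geq_eq; apply: perm_fib_sizes (bb) _ => x y.
  rewrite /step !(mem_imset _ _ (bij_inj bb)).
  case: ifP => _; case: ifP => _ //.
  by rewrite eqSS hb.
rewrite /trans_op /trans; under [RHS]eq_bigr do rewrite mulr_suml.
rewrite /avg (partition_big (@move n (profile f hC)) predT) //=; apply: eq_bigr => m _.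
by apply: eq_bigr => S /eqP ->.
Qed.

(* Expectation of [G g] where [g] gives the ages of the cards after [M] moves,
   starting from ages [f]. *)
Fixpoint age_mean (C : finType) (M : nat) (G : (C -> nat) -> R) (f : C -> nat) : R :=
  if M is M'.+1 then avg (fun S => age_mean M' G (step f S)) else G f.

Lemma age_mean_profile n (C : finType) (hC : #|C| = n) M (F : intpart n -> R)
    (f : C -> nat) :
  age_mean M (fun g => F (profile g hC)) f = iter M (@trans_op n) F (profile f hC).
Proof.
elim: M f => [//|M IH] f /=.
by rewrite -avg_step_profile; apply: eq_bigr => S _; rewrite IH.
Qed.

Lemma age_meanD (C : finType) M (G H : (C -> nat) -> R) f :
  age_mean M (fun g => G g + H g) f = age_mean M G f + age_mean M H f.
Proof.
elim: M f => [//|M IH] f /=; rewrite /avg -big_split /=.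
by apply: eq_bigr => S _; rewrite IH mulrDr.
Qed.

Lemma age_meanZ (C : finType) M (a : R) (G : (C -> nat) -> R) f :
  age_mean M (fun g => a * G g) f = a * age_mean M G f.
Proof.
elim: M f => [//|M IH] f /=; rewrite /avg big_distrr /=.
by apply: eq_bigr => S _; rewrite IH mulrCA.
Qed.

Lemma age_mean_sum (C : finType) M (I : Type) (s : seq I)
    (G : I -> (C -> nat) -> R) f :
  age_mean M (fun g => \sum_(i <- s) G i g) f = \sum_(i <- s) age_mean M (G i) f.
Proof.
elim: M f => [//|M IH] f /=; rewrite /avg exchange_big /=.
by apply: eq_bigr => S _; rewrite IH big_distrr.
Qed.

Lemma avg_prod (C : finType) (u v : C -> R) :
  avg (fun S => \prod_c (if c \in S then u c else v c))
    = \prod_c (p * u c + (1 - p) * v c).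
Proof.
rewrite bigA_distr; apply: eq_bigr => S _.
rewrite -!prodr_const [X in X * _ * _]big_mkcond [X in _ * X * _]big_mkcond /=.
rewrite -!big_split /=; apply: eq_bigr => c _; rewrite inE.
by case: (c \in S) => /=; rewrite ?mul1r ?mulr1.
Qed.

(** Independence of the ages, with their law: a card has age [j < M] with probability
    [p * (1 - p) ^+ j], and with probability [(1 - p) ^+ M] it was never picked and its initial age
    grew by [M]. *)
Lemma age_mean_prod (C : finType) M (w : C -> nat -> R) f :
  age_mean M (fun g => \prod_c w c (g c)) f
    = \prod_c (\sum_(j < M) p * (1 - p) ^+ j * w c j + (1 - p) ^+ M * w c (f c + M)%N).
Proof.
elim: M f => [|M IH] f /=.
  by apply: eq_bigr => c _; rewrite big_ord0 add0r mul1r addn0.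
pose W c x := \sum_(j < M) p * (1 - p) ^+ j * w c j + (1 - p) ^+ M * w c (x + M)%N.
transitivity (avg (fun S => \prod_c (if c \in S then W c 0%N else W c (f c).+1))).
  apply: eq_bigr => S _; rewrite IH; congr (_ * _); apply: eq_bigr => c _.
  by rewrite /W /step; case: ifP.
rewrite avg_prod; apply: eq_bigr => c _; rewrite /W big_ord_recr /= exprS add0n addSnnS.
ring.
Qed.

Lemma sum_geometric M : \sum_(j < M) p * (1 - p) ^+ j + (1 - p) ^+ M = 1.
Proof.
elim: M => [|M IH]; first by rewrite big_ord0 add0r.
rewrite big_ord_recr /= exprS -[RHS]IH; ring.
Qed.

(** Generating function of a binomial variable, obtained by writing the power as a product over
    cards. As [i < M], a card never picked cannot have age [i]. *)
Lemma age_mean_fib (C : finType) M i (z : R) f : (i < M)%N ->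
  age_mean M (fun g : C -> nat => z ^+ fib g i) f
    = (1 + p * (1 - p) ^+ i * (z - 1)) ^+ #|C|.
Proof.
move=> iM.
transitivity (age_mean M (fun g : C -> nat => \prod_c (if g c == i then z else 1)) f).
  by congr age_mean; apply/funext => g; rewrite -big_mkcond prodr_const.
rewrite (age_mean_prod M (fun _ x => if x == i then z else 1)) -prodr_const.
apply: eq_bigr => c _ /=.
rewrite gtn_eqF ?mulr1 ?(leq_trans iM) ?leq_addl //.
rewrite -[X in _ = X + _](sum_geometric M) [RHS]addrAC; congr (_ + _).
rewrite (bigD1 (Ordinal iM)) //= eqxx [in RHS](bigD1 (Ordinal iM)) //=.
rewrite (eq_bigr (fun j : 'I_M => p * (1 - p) ^+ j)); first by ring.
by move=> j; rewrite -val_eqE /= => /negPf ->; rewrite mulr1.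
Qed.

Lemma age_mean_old (C : finType) M (d : C) f :
  age_mean M (fun g : C -> nat => (M <= g d)%N%:R) f = (1 - p) ^+ M.
Proof.
transitivity (age_mean M (fun g : C -> nat =>
   \prod_c (if c == d then (M <= g c)%N%:R else 1)) f).
  by congr age_mean; apply/funext => g; rewrite -big_mkcond big_pred1_eq.
rewrite (age_mean_prod M (fun c x => if c == d then (M <= x)%N%:R else 1)).
rewrite (bigD1 d) //= eqxx leq_addl mulr1 big1 => [|j _]; last first.
  by rewrite leqNgt ltn_ord mulr0.
rewrite add0r big1 ?mulr1 // => c /negPf ->.
by rewrite -[RHS](sum_geometric M) mulr1; congr (_ + _); apply: eq_bigr => j _; rewrite mulr1.
Qed.

Hypothesis p01 : 0 < p < 1.

Lemma age_mean_le (C : finType) M (G H : (C -> nat) -> R) f :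
  (forall g, G g <= H g) -> age_mean M G f <= age_mean M H f.
Proof.
case/andP: p01 => p0 p1 GH; elim: M f => [//|M IH] f /=.
apply: ler_sum => S _; apply: ler_wpM2l (IH _).
by rewrite mulr_ge0 // exprn_ge0 // ?subr_ge0 ltW.
Qed.

(** Stationarity allows [M] further moves before [F] is evaluated, so a bound uniform in the initial
    ages is enough. *)
Lemma stationary_mean_le n (nu : intpart n -> R) (F : intpart n -> R) M B :
  is_stationary p nu ->
  (forall (C : finType) (hC : #|C| = n) (f : C -> nat),
    age_mean M (fun g => F (profile g hC)) f <= B) ->
  \sum_l nu l * F l <= B.
Proof.
move=> [[nu0 nu1] st] hB.
have -> : \sum_l nu l * F l = \sum_l nu l * iter M (@trans_op n) F l.
  elim: M {hB} => [//|M ->] /=.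
  under [RHS]eq_bigr do rewrite big_distrr /=.
  rewrite exchange_big /=; apply: eq_bigr => m _.
  by rewrite -[in LHS]st big_distrl /=; apply: eq_bigr => l _; rewrite mulrA.
rewrite -[leRHS]mul1r -nu1 big_distrl /=; apply: ler_sum => l _.
apply: ler_wpM2l => //.
(* The index of its pile serves as the fictitious initial age of a card. *)
have <- : profile (fun c : cards l => nat_of_ord (tag c)) (card_cards l) = l.
  rewrite -[RHS]profile_tag; apply: val_inj => /=; apply: sort_geq_eq.
  by apply: (@perm_fib_sizes _ _ _ _ _ _ id) => //; exists id.
by rewrite -age_mean_profile.
Qed.

End LabelledMove.

(** * Exponential inequalities for Chernoff's bound *)

Section ExpBounds.
Variable R : realType.

Lemma ge0_is_derive_le (f df : R -> R) (x : R) :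
  (forall y : R, is_derive y (1 : R) f (df y)) -> (forall y, 0 < y -> 0 <= df y) ->
  0 <= x -> f 0 <= f x.
Proof.
move=> fd df0 x0; apply: (@ger0_derive1_ndecry R f 0) => //.
- by move=> y; rewrite in_itv /= andbT => y0; rewrite derive1E derive_val df0.
- apply: continuous_subspaceT => y; apply: differentiable_continuous.
  by apply/derivable1_diffP; case: (fd y).
Qed.

(** Padé approximation of the exponential: the difference of the two sides has derivative
    [1 - (1 - y) * expR y], nonnegative because [1 - y <= expR (- y)]. *)
Lemma expR_le_ratio (s : R) : 0 <= s -> (2 - s) * expR s <= 2 + s.
Proof.
move=> s0; rewrite -subr_ge0.
have := @ge0_is_derive_le (fun y => 2 + y - (2 - y) * expR y)
  (fun y => 1 - (1 - y) * expR y) s.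
rewrite /= addr0 subr0 expR0 mulr1 subrr; apply => //.
  by move=> y; apply: is_derive_eq; rewrite /GRing.scale /=; ring.
move=> y y0; rewrite subr_ge0 -ler_pdivlMr ?expR_gt0 // div1r -expRN.
exact: expR_ge1Dx.
Qed.

Lemma expR_ge_quadratic (s : R) : 0 <= s -> 1 + s + s ^+ 2 / 2 <= expR s.
Proof.
move=> s0; rewrite -subr_ge0.
have := @ge0_is_derive_le (fun y => expR y - (1 + y + y ^+ 2 / 2))
  (fun y => expR y - (1 + y)) s.
rewrite /= expR0 expr0n /= mul0r !addr0 subrr; apply => //.
  by move=> y; apply: is_derive_eq; rewrite /GRing.scale /=; field.
by move=> y y0; rewrite subr_ge0 expR_ge1Dx.
Qed.

(* The value [s] of the exponential parameter in Chernoff's bound: it is the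
   rational approximation [2e/(2+e)] of the optimal [ln (1+e)]. *)
Definition chernoff_param (e : R) := 2 * e / (2 + e).

Variable e : R.
Local Notation s := (chernoff_param e).

Lemma chernoff_param_ge0 : 0 < e -> 0 <= s.
Proof. by move=> e0; rewrite /chernoff_param divr_ge0 //; lra. Qed.

(** The exponent per unit of mean in Markov's inequality, once [e - s] bounds the centred
    logarithmic moment for either tail. *)
Lemma chernoff_param_exponent : 0 < e -> (e - s) - s * e = - (e ^+ 2 / (2 + e)).
Proof. by move=> e0; rewrite /chernoff_param; field; rewrite gt_eqF //; lra. Qed.

(** Upper tail: [s] solves [(2 + s) / (2 - s) = 1 + e], so the Padé bound gives
    [expR s <= 1 + e]. *)
Lemma expR_chernoff_param : 0 < e -> expR s - 1 - s <= e - s.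
Proof.
move=> e0; have h := expR_le_ratio (chernoff_param_ge0 e0).
have e2 : 0 < 2 + e by lra.
have E1 : 2 - s = 4 / (2 + e) by rewrite /chernoff_param; field; rewrite gt_eqF.
have E2 : 2 + s = (4 / (2 + e)) * (1 + e).
  by rewrite /chernoff_param; field; rewrite gt_eqF.
move: h; rewrite E1 E2 ler_pM2l; first lra.
by rewrite divr_gt0.
Qed.

(** Lower tail: the left side is at most [s ^+ 2 / 2], which the same [s] keeps below [e - s]. *)
Lemma expRN_chernoff_param : 0 < e -> expR (- s) - 1 + s <= e - s.
Proof.
move=> e0; have s0 := chernoff_param_ge0 e0; set x := s in s0 *.
have e2 : 0 < 2 + e by lra.
have q0 : 0 < 1 + x + x ^+ 2 / 2 by nra.
have h1 : expR (- x) <= 1 - x + x ^+ 2 / 2.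
  rewrite expRN invf_ple ?posrE ?expR_gt0 //; last by nra.
  apply: le_trans (expR_ge_quadratic s0).
  rewrite -div1r ler_pdivrMr; last by nra.
  have : 0 <= x ^+ 4 by rewrite exprn_ge0.
  have -> : (1 + x + x ^+ 2 / 2) * (1 - x + x ^+ 2 / 2) = 1 + x ^+ 4 / 4 by field.
  lra.
have h2 : x ^+ 2 / 2 <= e - x.
  have -> : e - x = e ^+ 2 / (2 + e) by rewrite /x /chernoff_param; field; rewrite gt_eqF.
  have -> : x ^+ 2 / 2 = (e ^+ 2 / (2 + e)) * (2 / (2 + e)).
    by rewrite /x /chernoff_param; field; rewrite gt_eqF.
  rewrite ler_piMr //; first by rewrite divr_ge0 // ?exprn_ge0; lra.
  by rewrite ler_pdivrMr //; lra.
lra.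
Qed.

End ExpBounds.

(** * Concentration of the pile sizes *)

Section Tail.
Variables (R : realType) (p : R).
Hypothesis p01 : 0 < p < 1.

(** The binomial generating function at [expR u] is compared with the Poisson one by
    [1 + y <= expR y]; [b] is the threshold of Markov's inequality. *)
Lemma age_mean_expR_fib (C : finType) M i (u b : R) f : (i < M)%N ->
  age_mean p M (fun g : C -> nat =>
    expR (u * ((fib g i)%:R - #|C|%:R * p * (1 - p) ^+ i) - b)) f
    <= expR (#|C|%:R * p * (1 - p) ^+ i * (expR u - 1 - u) - b).
Proof.
move=> iM; case/andP: p01 => p0 p1.
set mu := #|C|%:R * p * (1 - p) ^+ i; set r := p * (1 - p) ^+ i.
have muE : mu = #|C|%:R * r by rewrite /mu /r mulrA.
rewrite (_ : (fun g => _) =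
  (fun g : C -> nat => expR (- (u * mu) - b) * expR u ^+ fib g i)); last first.
  by apply/funext => g; rewrite -expRM_natr -expRD; congr expR; ring.
rewrite age_meanZ age_mean_fib //.
rewrite (_ : mu * _ - b = (- (u * mu) - b) + r * (expR u - 1) * #|C|%:R); last first.
  by rewrite muE; ring.
rewrite [leRHS]expRD ler_pM2l ?expR_gt0 // expRM_natr lerXn2r ?nnegrE ?expR_ge0 //; last first.
  exact: expR_ge1Dx.
have r0 : 0 <= r by rewrite /r mulr_ge0 ?exprn_ge0 ?subr_ge0 // ltW.
have r1 : r <= 1.
  by rewrite /r mulr_ile1 // ?exprn_ge0 ?exprn_ile1 ?subr_ge0 ?gerBl // ltW.
have := expR_gt0 u; rewrite -/r; nra.
Qed.

Variables (n : nat) (e : R).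
Hypothesis e0 : 0 < e.

Definition near_geometric : set (intpart n) :=
  [set l | forall i, `|(part l i)%:R - n%:R * p * (1 - p) ^+ i| <= e * (n%:R * p)]%classic.

(** Pointwise union bound: some label deviates, and either it is below [M] and one of its two
    exponentials exceeds 1, or it is at least [M] and some card is that old. *)
Lemma profile_not_near_geometric (C : finType) (hC : #|C| = n) M (g : C -> nat) :
  let s := chernoff_param e in
  let dev i := (fib g i)%:R - #|C|%:R * p * (1 - p) ^+ i in
  (1 - p) ^+ M <= e ->
  (profile g hC \notin near_geometric)%:R <=
    \sum_c (M <= g c)%N%:R +
    \sum_(i < M) (expR (s * dev i - s * (e * (n%:R * p)))
                + expR (- s * dev i - s * (e * (n%:R * p)))) :> R.
Proof.
move=> s dev qM; case/andP: p01 => p0 p1.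
have np0 : 0 <= n%:R * p by rewrite mulr_ge0 // ltW.
set t := e * _; set A := \sum_c _; set B := \sum_(i < M) _.
have s0 : 0 <= s by exact: chernoff_param_ge0.
have A0 : 0 <= A by apply: sumr_ge0 => c _; rewrite ler0n.
have B0 : 0 <= B by apply: sumr_ge0 => i _; rewrite addr_ge0 // expR_ge0.
case: (boolP (_ \in _)) => [_|]; first by rewrite addr_ge0.
move=> bad; have [j hj] : exists j, t < `|dev j|.
  apply: contrapT => hno; move/negP: bad; apply; rewrite inE.
  apply: part_profile_dist => [i j ij|j].
    by rewrite ler_wpM2l // ler_wiXn2l // ?subr_ge0 ?gerBl ltW.
  by rewrite leNgt; apply/negP => h; apply: hno; exists j; rewrite /dev hC.
have [jM|Mj] := ltnP j M.
  apply: (@le_trans _ _ B); last by rewrite lerDr.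
  rewrite /B (bigD1 (Ordinal jM)) //= -[leLHS]addr0; apply: lerD; last first.
    by apply: sumr_ge0 => i _; rewrite addr_ge0 // expR_ge0.
  have [h|h] := leP 0 (dev j).
    rewrite ger0_norm // in hj.
    apply: (@le_trans _ _ (expR (s * dev j - s * t))); last by rewrite lerDl expR_ge0.
    by rewrite -expR0 ler_expR subr_ge0 ler_wpM2l // ltW.
  rewrite ltr0_norm // in hj.
  apply: (@le_trans _ _ (expR (- s * dev j - s * t))); last by rewrite lerDr expR_ge0.
  by rewrite -expR0 ler_expR subr_ge0 mulNr -mulrN ler_wpM2l // ltW.
apply: (@le_trans _ _ A); last by rewrite lerDl.
have [/card_gt0P[c]|] := boolP (0 < fib g j)%N.
  rewrite inE => /eqP gc; rewrite /A (bigD1 c) //= gc Mj lerDl.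
  by apply: sumr_ge0 => d _; rewrite ler0n.
(* An empty fibre deviates by its mean only, which [qM] keeps within tolerance: a contradiction. *)
rewrite -eqn0Ngt => /eqP f0; move: hj; rewrite /dev f0 sub0r normrN hC.
rewrite ger0_norm; last by rewrite !mulr_ge0 ?exprn_ge0 ?subr_ge0 // ltW.
rewrite /t mulrC ltNge ler_wpM2l //.
by apply: le_trans qM; rewrite ler_wiXn2l // ?subr_ge0 ?gerBl ltW.
Qed.

Lemma Pr_near_geometric (nu : intpart n -> R) M :
  is_stationary p nu -> (1 - p) ^+ M <= e ->
  1 - (n%:R * (1 - p) ^+ M + 2 * M%:R * expR (- (n%:R * p * (e ^+ 2 / (2 + e)))))
    <= Pr nu near_geometric.
Proof.
move=> st qM; case/andP: p01 => p0 p1.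
have PrE : Pr nu near_geometric = 1 - \sum_l nu l * (l \notin near_geometric)%:R.
  case: st => [[_ nu1] _]; rewrite -[X in X - _]nu1 (bigID (fun l => l \in near_geometric)) /=.
  rewrite -[LHS]addr0 -addrA; congr (_ + _); apply/esym/eqP; rewrite subr_eq0; apply/eqP.
  by rewrite big_mkcond; apply: eq_bigr => l _; case: (_ \in _); rewrite ?mulr1 ?mulr0.
rewrite PrE lerD2l lerN2.
apply: (stationary_mean_le st (M := M)) => C hC f.
apply: le_trans (age_mean_le p01 M f (fun g => profile_not_near_geometric hC g qM)) _.
rewrite age_meanD !age_mean_sum; apply: lerD.
  rewrite (eq_bigr (fun=> (1 - p) ^+ M)); last by move=> c _; rewrite age_mean_old.
  by rewrite sumr_const hC mulr_natl.
have np0 : 0 <= n%:R * p by rewrite mulr_ge0 // ltW.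
set s := chernoff_param e; set E := expR _.
(* Since [expR u - 1 - u] is nonnegative, each mean can be replaced by the largest, [n%:R * p]. The
   two tails take [u] to be [s] and [- s]. *)
have key u i : (i < M)%N -> expR u - 1 - u <= e - s ->
  age_mean p M (fun g : C -> nat =>
    expR (u * ((fib g i)%:R - #|C|%:R * p * (1 - p) ^+ i) - s * (e * (n%:R * p)))) f <= E.
  move=> iM hu; apply: le_trans (age_mean_expR_fib _ _ _ iM) _.
  rewrite /E ler_expR hC -[leRHS]mulrN -(chernoff_param_exponent e0) -/s.
  have h1 : n%:R * p * (1 - p) ^+ i * (expR u - 1 - u) <= n%:R * p * (e - s).
    apply: ler_pM => //.
    - by rewrite mulr_ge0 // exprn_ge0 // subr_ge0 ltW.
    - by rewrite -addrA -opprD subr_ge0 expR_ge1Dx.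
    - by rewrite ler_piMr // exprn_ile1 //; lra.
  by have : s * (e * (n%:R * p)) = n%:R * p * (s * e) by [ring]; lra.
apply: (@le_trans _ _ (\sum_(i < M) (E + E))); last first.
  by rewrite sumr_const card_ord (_ : 2 * _ * E = M%:R * (E + E)) ?mulr_natl //; ring.
apply: ler_sum => i _; rewrite age_meanD; apply: lerD; apply: key => //.
  exact: expR_chernoff_param.
by rewrite opprK expRN_chernoff_param.
Qed.

End Tail.

(** * From the geometric profile to the exponential, for fixed [n] *)

Section Boundary.
Variables (R : realType) (p : R).
Hypothesis p01 : 0 < p < 1.

(** Both bounds come from [expR (- (p / (1 - p))) <= 1 - p <= expR (- p)] and
    [x - p <= p * k%:R <= x]; [x * expR (- x) <= 1] makes the lower one uniform in [x]. *)
Lemma geometric_expR_dist (x : R) : 0 <= x ->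
  `|(1 - p) ^+ Num.truncn (1 / p * x) - expR (- x)| <= p / (1 - p).
Proof.
move=> x0; case/andP: p01 => p0 p1; set k := Num.truncn _.
have q0 : 0 < 1 - p by lra.
have /andP[kx xk] : k%:R <= 1 / p * x < k.+1%:R.
  by apply: truncn_itv; rewrite mulr_ge0 // divr_ge0 // ltW.
have {}kx : p * k%:R <= x by rewrite -ler_pdivlMl // -div1r.
have {}xk : x - p <= p * k%:R.
  move: xk; rewrite div1r ltr_pdivrMl // -natr1 => h; lra.
have E0 := expR_gt0 (- x); have E1 : expR (- x) <= 1 by rewrite expR_le1; lra.
have pq0 : 0 < p / (1 - p) by rewrite divr_gt0.
have up : (1 - p) ^+ k <= expR (- x) * (1 + p / (1 - p)).
  apply: (@le_trans _ _ (expR (- p) ^+ k)).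
    by rewrite lerXn2r ?nnegrE ?expR_ge0 ?(ltW q0) //; have := expR_ge1Dx (- p); lra.
  rewrite -expRM_natr; apply: (@le_trans _ _ (expR (- x) * expR p)).
    by rewrite -expRD ler_expR; lra.
  rewrite ler_pM2l // (_ : 1 + p / _ = (1 - p)^-1); last by field; rewrite gt_eqF.
  rewrite -[p in leLHS]opprK expRN lef_pV2 ?posrE ?expR_gt0 //.
  by have := expR_ge1Dx (- p); lra.
have lo : expR (- x) * (1 - x * (p / (1 - p))) <= (1 - p) ^+ k.
  apply: (@le_trans _ _ (expR (- (p / (1 - p))) ^+ k)); last first.
    rewrite lerXn2r ?nnegrE ?expR_ge0 ?(ltW q0) // expRN.
    rewrite -[leRHS]invrK lef_pV2 ?posrE ?expR_gt0 ?invr_gt0 //.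
    apply: le_trans (expR_ge1Dx _).
    by rewrite (_ : 1 + p / _ = (1 - p)^-1) //; field; rewrite gt_eqF.
  rewrite -expRM_natr; apply: (@le_trans _ _ (expR (- x) * expR (- (x * (p / (1 - p)))))).
    by rewrite ler_pM2l //; have := expR_ge1Dx (- (x * (p / (1 - p)))); lra.
  rewrite -expRD ler_expR.
  have -> : - (p / (1 - p)) * k%:R = - (p * k%:R + p * k%:R * (p / (1 - p))).
    by field; rewrite gt_eqF.
  rewrite -opprD lerN2; apply: lerD => //.
  by rewrite ler_pM2r.
have xE : x * expR (- x) <= 1.
  rewrite expRN ler_pdivrMr ?expR_gt0 // mul1r.
  by have := expR_ge1Dx x; lra.
rewrite ler_norml; apply/andP; split; nra.
Qed.

Lemma supnorm_near_geometric n (l : intpart n) (e : R) : (0 < n)%N ->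
  near_geometric p e l ->
  (supnorm (fun x : R => boundary (1 / p) l x - expR (- x))%R
    <= (e + p / (1 - p))%:E)%E.
Proof.
move=> n0 hl; case/andP: p01 => p0 p1; rewrite /supnorm.
apply: ge_ereal_sup => _ [x /= x0 <-]; rewrite lee_fin /boundary.
set k := Num.truncn _.
have np0 : 0 < n%:R * p by rewrite mulr_gt0 // ltr0n.
have -> : 1 / p / n%:R * (part l k)%:R - expR (- x) =
  ((part l k)%:R - n%:R * p * (1 - p) ^+ k) / (n%:R * p)
  + ((1 - p) ^+ k - expR (- x)).
  by field; rewrite !gt_eqF // ltr0n.
apply: le_trans (ler_normD _ _) _; apply: lerD; last exact: geometric_expR_dist.
by rewrite normrM normfV (gtr0_norm np0) ler_pdivrMr.
Qed.

Lemma Pr_le (T : finType) (nu : T -> R) (A B : set T) :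
  is_distr nu -> (forall t, A t -> B t) -> Pr nu A <= Pr nu B.
Proof.
move=> [nu0 _] AB; rewrite /Pr [leRHS](bigID (fun t => t \in A)) /=.
rewrite -[leLHS]addr0; apply: lerD; last exact: sumr_ge0.
rewrite le_eqVlt; apply/orP; left; apply/eqP; apply: eq_bigl => t.
apply/idP/andP => [h|[]//]; split => //.
by rewrite inE; apply: AB; move: h; rewrite inE.
Qed.

Lemma Pr_le1 (T : finType) (nu : T -> R) (A : set T) : is_distr nu -> Pr nu A <= 1.
Proof.
move=> [nu0 nu1]; rewrite -nu1 /Pr [leRHS](bigID (fun t => t \in A)) /=.
by rewrite lerDl; apply: sumr_ge0.
Qed.

(** The number of moves is [K * n]. As [ln n <= n p], the choice [K >= eps + 1] brings the old-card
    term below the Chernoff factor [E]; the total [(2 K n + 1) E] is at most [n ^ 2 E] because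
    [2 K + 1 <= n]. *)
Lemma Pr_supnorm_ge n (nu : intpart n -> R) (eps e : R) (K : nat) :
  is_stationary p nu -> (0 < n)%N -> 0 < eps -> eps + 1 <= K%:R ->
  (2 * K + 1 <= n)%N -> ln (n%:R : R) <= n%:R * p ->
  e = eps - p / (1 - p) -> 0 < e -> 1 <= e * n%:R ->
  1 - expR (2 * ln (n%:R : R) - n%:R * p * (e ^+ 2 / (2 + e)))
   <= Pr nu [set l | (supnorm (fun x : R => boundary (1 / p) l x - expR (- x))%R
                        <= eps%:E)%E]%classic.
Proof.
move=> st n0 eps0 hK Kn lnp eE e0 en; case/andP: p01 => p0 p1.
have nR : 0 < n%:R :> R by rewrite ltr0n.
set E := expR (- (n%:R * p * (e ^+ 2 / (2 + e)))).
have Eexp : expR (2 * ln (n%:R : R) - n%:R * p * (e ^+ 2 / (2 + e))) = n%:R ^+ 2 * E.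
  rewrite expRD -/E; congr (_ * _).
  by rewrite mulrC expRM_natr lnK.
have E0 : 0 < E by exact: expR_gt0.
have e2 : 0 <= e ^+ 2 / (2 + e) by rewrite divr_ge0 ?exprn_ge0 //; lra.
have np0 : 0 < n%:R * p by rewrite mulr_gt0.
have E1 : E <= 1 by rewrite /E expR_le1 oppr_le0 mulr_ge0 // ltW.
have e_eps : e <= eps by rewrite eE gerBl divr_ge0 //; lra.
have e2e : e ^+ 2 / (2 + e) <= e.
  by rewrite ler_pdivrMr; [nra|lra].
have qM : n%:R * (1 - p) ^+ (K * n) <= E.
  apply: (@le_trans _ _ (expR (ln n%:R) * expR (- p) ^+ (K * n))).
    rewrite lnK ?posrE // ler_pM2l // lerXn2r ?nnegrE ?expR_ge0 //; first lra.
    by have := expR_ge1Dx (- p); lra.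
  rewrite -expRM_natr -expRD /E ler_expR natrM.
  have : n%:R * p * (eps + 1) <= n%:R * p * K%:R by rewrite ler_pM2l.
  have : n%:R * p * (e ^+ 2 / (2 + e)) <= n%:R * p * eps by rewrite ler_pM2l //; lra.
  lra.
(* By [qM] the power is at most [1 / n], hence at most [e]. *)
have qe : (1 - p) ^+ (K * n) <= e.
  by rewrite -(ler_pM2l nR) (le_trans qM) // (le_trans E1) // mulrC.
apply: (@le_trans _ _ (Pr nu (near_geometric p e))); last first.
  apply: Pr_le; first by case: st.
  move=> l hl /=; rewrite (_ : eps = e + p / (1 - p)); last by rewrite eE subrK.
  exact: supnorm_near_geometric.
apply: le_trans (Pr_near_geometric p01 e0 st qe).
rewrite lerD2l lerN2 Eexp -/E.
apply: (@le_trans _ _ ((2 * (K * n)%:R + 1) * E));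
  first by rewrite [leRHS]mulrDl mul1r addrC lerD2l.
rewrite ler_pM2r // -natrM natr1 -natrX ler_nat.
have : (n * (2 * K + 1) <= n * n)%N by rewrite leq_mul2l Kn orbT.
rewrite -mulnn; apply: leq_trans; rewrite mulnDr muln1 (mulnCA n) (mulnC n K).
by rewrite -[X in (X <= _)%N]addn1 leq_add2l.
Qed.

End Boundary.

Local Open Scope classical_set_scope.
Local Open Scope ring_scope.

(** * Asymptotics of the error term *)

Section Asymptotics.
Variables (R : realType) (p : nat -> R).
Hypothesis p01 : forall n : nat, (0 < n)%N -> 0 < p n < 1.
Hypothesis p_to0 : p n @[n --> \oo] --> (0 : R).
Hypothesis p_large : p n / (ln (n%:R : R) / n%:R) @[n --> \oo] --> +oo.

Lemma ln_div_cvg0 : ln (n%:R : R) / (n%:R * p n) @[n --> \oo] --> (0 : R).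
Proof.
have -> : (fun n => ln (n%:R : R) / (n%:R * p n)) =
          (fun n => (p n / (ln (n%:R : R) / n%:R))^-1).
  by apply/funext => n; rewrite invf_div invfM mulrA.
apply/gtr0_cvgV0 => //.
near=> n; have n1 : (1 < n)%N by near: n; exact: nbhs_infty_gt.
have /andP[p0 _] := p01 (ltnW n1).
rewrite divr_gt0 // divr_gt0 ?ltr0n ?(ltnW n1) // ln_gt0 // ltr1n.
Unshelve. all: by end_near. Qed.

(** Once [ln n] is at least 1, [n p] dominates [n p / ln n], which diverges by hypothesis. *)
Lemma mean_cvgy : n%:R * p n @[n --> \oo] --> +oo.
Proof.
apply/cvgryPge => A; near=> n.
have n0 : (0 < n)%N by near: n; exact: nbhs_infty_gt.
have /andP[p0 _] := p01 n0.
have ln1 : 1 <= ln (n%:R : R).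
  rewrite -ler_expR lnK ?posrE ?ltr0n //; near: n; exact: nbhs_infty_ger.
apply: (@le_trans _ _ (p n / (ln (n%:R : R) / n%:R))).
  by near: n; move/cvgryPge: p_large; apply.
rewrite invf_div mulrCA ler_pM2l ?ltr0n //.
by rewrite ler_piMr ?(ltW p0) // invf_le1 // (lt_le_trans _ ln1).
Unshelve. all: by end_near. Qed.

Variable eps : R.
Hypothesis eps0 : 0 < eps.

Definition eff_eps n := eps - p n / (1 - p n).

Lemma eff_eps_cvg : eff_eps n @[n --> \oo] --> eps.
Proof.
rewrite -[X in _ --> X]subr0; apply: cvgB; first exact: cvg_cst.
rewrite -[X in _ --> X](mul0r (1 - 0)^-1); apply: cvgM => //.
apply: cvgV; first by rewrite subr0 oner_neq0.
by apply: cvgB => //; exact: cvg_cst.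
Qed.

(** The size conditions of [Pr_supnorm_ge], with [K] the least integer above [eps + 1]. *)
Definition large_enough n :=
  [&& (2 * (Num.truncn (eps + 1)).+1 + 1 <= n)%N, ln (n%:R : R) <= n%:R * p n,
      0 < eff_eps n & 1 <= eff_eps n * n%:R].

Lemma near_large_enough : \forall n \near \oo, large_enough n.
Proof.
near=> n; have n0 : (0 < n)%N by near: n; exact: nbhs_infty_gt.
have /andP[p0 _] := p01 n0.
have h : eps / 2 < eff_eps n.
  near: n; apply: (cvgr_gt eps eff_eps_cvg); move: (eps0); lra.
apply/and4P; split.
- by near: n; exact: nbhs_infty_ge.
- have : ln (n%:R : R) / (n%:R * p n) < 1.
    by near: n; apply: (cvgr_lt 0 ln_div_cvg0).
  by rewrite ltr_pdivrMr ?mulr_gt0 ?ltr0n // mul1r => /ltW.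
- by apply: lt_trans h; rewrite divr_gt0.
- have hn : 2 / eps <= n%:R by near: n; exact: nbhs_infty_ger.
  apply: (@le_trans _ _ (eps / 2 * (2 / eps))).
    by rewrite (_ : _ * _ = 1) //; field; rewrite gt_eqF.
  by apply: ler_pM => //; rewrite ?divr_ge0 // ltW.
Unshelve. all: by end_near. Qed.

(* The value 1 makes the bound trivial for the finitely many other [n]. *)
Definition error_term n :=
  let c := eps ^+ 2 / (2 + eps) in
  if large_enough n then
    1 - (eff_eps n ^+ 2 / (2 + eff_eps n) / c - 2 / c * (ln (n%:R : R) / (n%:R * p n)))
  else 1.

Lemma error_term_cvg : error_term n @[n --> \oo] --> (0 : R).
Proof.
set c := eps ^+ 2 / (2 + eps).
have c0 : 0 < c by rewrite divr_gt0 ?exprn_gt0 //; move: (eps0); lra.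
have e2 : 0 < 2 + eps by move: (eps0); lra.
pose u n := 1 - (eff_eps n ^+ 2 / (2 + eff_eps n) / c
              - 2 / c * (ln (n%:R : R) / (n%:R * p n))).
suff h : u n @[n --> \oo] --> (0 : R).
  apply: cvg_trans h; apply: near_eq_cvg; near=> n.
  by rewrite /error_term ifT //; near: n; exact: near_large_enough.
have -> : (0 : R) = 1 - (eps ^+ 2 / (2 + eps) / c - 2 / c * 0).
  by rewrite mulr0 subr0 -/c divff ?subrr // gt_eqF.
apply: cvgB; first exact: cvg_cst.
apply: cvgB.
  apply: cvgM; last exact: cvg_cst.
  apply: cvgM; first exact: cvgM eff_eps_cvg eff_eps_cvg.
  apply: cvgV; first by rewrite gt_eqF.
  by apply: cvgD; [exact: cvg_cst|exact: eff_eps_cvg].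
by apply: cvgM; [exact: cvg_cst|exact: ln_div_cvg0].
Unshelve. all: by end_near. Qed.

Lemma Pr_supnorm_error_term n (nu : intpart n -> R) :
  (0 < n)%N -> is_stationary (p n) nu ->
  1 - expR (- (eps ^+ 2 / (2 + eps) * (n%:R * p n) * (1 - error_term n)))
  <= Pr nu [set l : intpart n |
          (supnorm (fun x : R => boundary (1 / p n) l x - expR (- x))%R
            <= eps%:E)%E].
Proof.
move=> n0 st; rewrite /error_term; set c := eps ^+ 2 / _.
have e2 : 0 < 2 + eps by move: (eps0); lra.
have c0 : 0 < c by rewrite divr_gt0 ?exprn_gt0.
case: ifP => [/and4P[hK hln he hen]|_]; last first.
  rewrite subrr mulr0 oppr0 expR0 subrr; apply: sumr_ge0 => l _.
  by case: st => -[].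
have /andP[p0 p1] := p01 n0.
apply: le_trans (Pr_supnorm_ge (p01 n0) st n0 eps0 _ hK hln erefl he hen); last first.
  by apply: ltW; apply: real_truncnS_gt; rewrite num_real.
(* The exponents agree exactly: [error_term] was obtained by solving this equation. *)
rewrite lerD2l lerN2 ler_expR le_eqVlt; apply/orP; left; apply/eqP.
rewrite -/(eff_eps n); field.
by rewrite !gt_eqF ?ltr0n //; move: (he); lra.
Qed.

End Asymptotics.

Theorem corollary2 (R : realType) (p : nat -> R)
    (nu : forall n : nat, intpart n -> R)
    (p01 : forall n : nat, (0 < n)%N -> 0 < p n < 1)
    (p_to0 : p n @[n --> \oo] --> (0 : R))
    (p_large : p n / (ln (n%:R : R) / n%:R) @[n --> \oo] --> +oo)
    (nu_stationary : forall n : nat, (0 < n)%N -> is_stationary (p n) (nu n)) :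
  has_limit_shape nu (fun x : R => expR (- x)) (fun n => 1 / p n) /\
  (forall eps : R, 0 < eps ->
    exists2 o : nat -> R, o n @[n --> \oo] --> (0 : R) &
      forall n : nat, (0 < n)%N ->
        Pr (nu n) [set l : intpart n |
          (supnorm (fun x : R => boundary (1 / p n) l x - expR (- x))%R
            <= eps%:E)%E]
        >= 1 - expR (- (eps ^+ 2 / (2 + eps) * (n%:R * p n) * (1 - o n)))).
Proof.
split=> [delta delta0|eps eps0]; last first.
  exists (error_term p eps); first exact: error_term_cvg.
  by move=> n n0; apply: Pr_supnorm_error_term => //; exact: nu_stationary.
(* Half of [delta] turns the weak inequality of the bound into the strict one of the limit shape. *)
have d20 : 0 < delta / 2 by rewrite divr_gt0.
pose err := error_term p (delta / 2).
have err0 : err n @[n --> \oo] --> (0 : R) by exact: error_term_cvg.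
have herr n n0 := Pr_supnorm_error_term p01 d20 n0 (nu_stationary n n0).
set c := (delta / 2) ^+ 2 / (2 + delta / 2) in herr.
have c0 : 0 < c by rewrite divr_gt0 ?exprn_gt0 ?addr_gt0.
have Xy : c * (n%:R * p n) * (1 - err n) @[n --> \oo] --> +oo.
  apply/cvgryPge => A; near=> n.
  (* An error below one half leaves at least half of an exponent that diverges with [n p]. *)
  have h1 : err n < 1 / 2 by near: n; apply: (cvgr_lt 0 err0).
  have h2 : `|A| * 2 / c <= n%:R * p n.
    by near: n; move/cvgryPge: (mean_cvgy p01 p_large); apply.
  apply: (le_trans (ler_norm A)).
  rewrite (_ : `|A| = c * (`|A| * 2 / c) * (1 / 2)); last by field; rewrite gt_eqF.
  apply: ler_pM; rewrite ?ler_pM2l ?mulr_ge0 ?invr_ge0 ?(ltW c0) //; lra.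
apply: (@squeeze_cvgr _ _ _ _
  (fun n => 1 - expR (- (c * (n%:R * p n) * (1 - err n)))) (fun=> 1)).
- near=> n; have n0 : (0 < n)%N by near: n; exact: nbhs_infty_gt.
  have [dn _] := nu_stationary n n0.
  rewrite Pr_le1 // andbT; apply: le_trans (herr n n0) _.
  apply: Pr_le => // l /= hl; apply: le_lt_trans hl _; rewrite lte_fin; lra.
- rewrite -[X in _ --> X]subr0; apply: cvgB; first exact: cvg_cst.
  exact: (cvg_comp _ _ Xy (@cvgr_expR R)).
- exact: cvg_cst.
Unshelve. all: by end_near. Qed.
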